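(* Let $\vdash$ be the consequence relation of the logic $IR4^\star$ and let $\mathrm{Fml}$ be the algebra of formulas in the language $\{\to\}$. For every $\Gamma\cup\{\alpha\}\subseteq\mathrm{Fml}$: $\Gamma\vdash\alpha$ if and only if for every sub-Hilbert algebra $A$ and every homomorphism $h:\mathrm{Fml}\to A$ (with respect to $\to$), $h(\Gamma)\subseteq\{1\}$ implies $h(\alpha)=1$.
   Context: The logic $IR4^\star$ is the Hilbert-style calculus in the language $\{\to\}$ with axiom schemes $\alpha\to\alpha$; $(\alpha\to\beta)\to((\beta\to\delta)\to(\alpha\to\delta))$; $(\alpha\to(\beta\to\delta))\to((\alpha\to\beta)\to(\alpha\to\delta))$; and rules (MP) from $\alpha$ and $\alpha\to\beta$ infer $\beta$; (T) from $\alpha$ infer $\beta\to\alpha$. $\Gamma\vdash\alpha$ means there is a finite derivation of $\alpha$ from premises in $\Gamma$ (both rules may be applied to any previously derived formulas, including those depending on premises). A sub-Hilbert algebra is an algebra $(A,\to,1)$ of type $(2,0)$ satisfying, for all $x,y,z\in A$: (B) $(x\to y)\to((y\to z)\to(x\to z))=1$; (I) $x\to x=1$; (T) $x\to 1=1$; (A) if $x\to y=1$ and $y\to x=1$ then $x=y$; (S) $(x\to(y\to z))\to((x\to y)\to(x\to z))=1$. *)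

(* Defs.v *)
From Stdlib Require Import List.
Import ListNotations.

Declare Scope fml_scope.
Delimit Scope fml_scope with fml.

Inductive fml (V : Type) : Type :=
| Var : V -> fml V
| Imp : fml V -> fml V -> fml V.

Arguments Var {V} _.
Arguments Imp {V} _ _.

Bind Scope fml_scope with fml.
Notation "a ~> b" := (Imp a b) (at level 55, right associativity) : fml_scope.

Inductive ax_scheme {V : Type} : fml V -> Prop :=
| ax_I (a : fml V) : ax_scheme (a ~> a)
| ax_B (a b d : fml V) : ax_scheme ((a ~> b) ~> ((b ~> d) ~> (a ~> d)))
| ax_S (a b d : fml V) : ax_scheme ((a ~> (b ~> d)) ~> ((a ~> b) ~> (a ~> d))).

(* [step G l a]: [a] may be appended to a derivation from [G] whose formulas so
   far are those of [l].  Rule (T) is not restricted to theorems. *)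
Inductive step {V : Type} (G : fml V -> Prop) (l : list (fml V)) : fml V -> Prop :=
| step_premise (a : fml V) : G a -> step G l a
| step_axiom (a : fml V) : ax_scheme a -> step G l a
| step_MP (a b : fml V) : In a l -> In (a ~> b)%fml l -> step G l b
| step_T (a b : fml V) : In a l -> step G l (b ~> a).

(* Derivations are listed with the most recent formula first. *)
Inductive derivation {V : Type} (G : fml V -> Prop) : list (fml V) -> Prop :=
| derivation_nil : derivation G []
| derivation_cons (l : list (fml V)) (a : fml V) :
    derivation G l -> step G l a -> derivation G (a :: l).

Definition derivable {V : Type} (G : fml V -> Prop) (a : fml V) : Prop :=
  exists l : list (fml V), derivation G (a :: l).

Record subHilbertAlgebra : Type := SubHilbertAlgebra {
  carrier :> Type;
  arr : carrier -> carrier -> carrier;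
  one : carrier;
  sh_B : forall x y z : carrier,
    arr (arr x y) (arr (arr y z) (arr x z)) = one;
  sh_I : forall x : carrier, arr x x = one;
  sh_T : forall x : carrier, arr x one = one;
  sh_A : forall x y : carrier, arr x y = one -> arr y x = one -> x = y;
  sh_S : forall x y z : carrier,
    arr (arr x (arr y z)) (arr (arr x y) (arr x z)) = one
}.

Arguments arr {s} _ _.
Arguments one {s}.

Definition homomorphism {V : Type} {A : subHilbertAlgebra} (h : fml V -> A) : Prop :=
  forall a b : fml V, h (a ~> b)%fml = arr (h a) (h b).

(* Main.v *)
(** Soundness holds because (T) and (A) force [x = 1] whenever [1 -> x = 1], which
    validates modus ponens.  For completeness, take the Lindenbaum algebra of [G]:
    the preorder [G |- a -> b] is compatible with [->], since (B) makes implication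
    antitone on the left, and rule (T) followed by (S) makes it monotone on the
    right; rule (T) for premises puts all consequences of [G] in the class [1]. *)
From Stdlib Require Import List FunctionalExtensionality PropExtensionality ProofIrrelevance.
Require Import Defs.
Import ListNotations.
Local Open Scope fml_scope.

Section Derivability.

Context {V : Type} (G : fml V -> Prop).

Lemma step_incl (l l' : list (fml V)) (a : fml V) :
  incl l l' -> step G l a -> step G l' a.
Proof.
  intros Hl []; eauto using step.
Qed.

(** A step only asks which formulas occur earlier, so one derivation can be replayed on top of
    another. This brings the two premises of (MP), derived separately, into a single list. *)
Lemma derivation_app (l l' : list (fml V)) :
  derivation G l -> derivation G l' -> derivation G (l ++ l').
Proof.
  intros Hl Hl'; induction Hl as [|l a _ IH Ha]; simpl; [assumption|].
  constructor; [assumption|].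
  apply step_incl with l; [apply incl_appl, incl_refl | assumption].
Qed.

Lemma derivable_premise (a : fml V) : G a -> derivable G a.
Proof.
  intros Ha; exists []; constructor; [constructor | now apply step_premise].
Qed.

Lemma derivable_axiom (a : fml V) : ax_scheme a -> derivable G a.
Proof.
  intros Ha; exists []; constructor; [constructor | now apply step_axiom].
Qed.

Lemma derivable_T (a b : fml V) : derivable G a -> derivable G (b ~> a).
Proof.
  intros [l Hl]; exists (a :: l); constructor; [assumption|].
  apply step_T; now left.
Qed.

Lemma derivable_MP (a b : fml V) :
  derivable G a -> derivable G (a ~> b) -> derivable G b.
Proof.
  intros [l Hl] [l' Hl']; exists ((a :: l) ++ (a ~> b) :: l').
  constructor; [now apply derivation_app|].
  apply step_MP with a; apply in_or_app; [left | right]; now left.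
Qed.

Lemma derivable_refl (a : fml V) : derivable G (a ~> a).
Proof. apply derivable_axiom, ax_I. Qed.

Lemma derivable_antitone_l (a b d : fml V) :
  derivable G (a ~> b) -> derivable G ((b ~> d) ~> (a ~> d)).
Proof.
  intros H; apply (derivable_MP _ _ H), derivable_axiom, ax_B.
Qed.

Lemma derivable_trans (a b d : fml V) :
  derivable G (a ~> b) -> derivable G (b ~> d) -> derivable G (a ~> d).
Proof.
  intros Hab Hbd; apply (derivable_MP _ _ Hbd), derivable_antitone_l, Hab.
Qed.

Lemma derivable_monotone_r (a b d : fml V) :
  derivable G (b ~> d) -> derivable G ((a ~> b) ~> (a ~> d)).
Proof.
  intros H; apply (derivable_MP _ _ (derivable_T _ a H)), derivable_axiom, ax_S.
Qed.

End Derivability.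

Lemma one_arr_eq_one (A : subHilbertAlgebra) (x : A) : arr one x = one -> x = one.
Proof.
  intros H; apply sh_A; [apply sh_T | exact H].
Qed.

Lemma ax_scheme_valid {V : Type} (A : subHilbertAlgebra) (h : fml V -> A) (a : fml V) :
  homomorphism h -> ax_scheme a -> h a = one.
Proof.
  intros Hh []; repeat rewrite Hh; [apply sh_I | apply sh_B | apply sh_S].
Qed.

Lemma derivation_sound {V : Type} (G : fml V -> Prop) (A : subHilbertAlgebra)
    (h : fml V -> A) (l : list (fml V)) :
  homomorphism h -> (forall g, G g -> h g = one) ->
  derivation G l -> forall b, In b l -> h b = one.
Proof.
  intros Hh HG Hl; induction Hl as [|l a _ IH Ha]; intros b; [intros []|].
  intros [<-|Hb]; [|now apply IH].
  destruct Ha as [a Ha|a Ha|a c Ha Hac|a c Ha].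
  - now apply HG.
  - now apply ax_scheme_valid.
  (* Reading the left [one] in [arr one (h c)] as [h a] turns the goal into the validity of
     [a ~> c], an earlier entry. *)
  - apply one_arr_eq_one; rewrite <- (IH a Ha) at 1; rewrite <- Hh; now apply IH.
  - rewrite Hh, (IH a Ha); apply sh_T.
Qed.

Section Lindenbaum.

Context {V : Type} (G : fml V -> Prop).

(* The class of [a] is represented by the up-set it generates in the preorder
   [G |- a -> b], so that interderivable formulas get equal classes. *)
Definition upset (a : fml V) : fml V -> Prop := fun b => derivable G (a ~> b).

Lemma upset_eq_iff (a b : fml V) :
  upset a = upset b <-> derivable G (a ~> b) /\ derivable G (b ~> a).
Proof.
  split.
  - intros H; split.
    + change (upset a b); rewrite H; apply derivable_refl.
    + change (upset b a); rewrite <- H; apply derivable_refl.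
  - intros [Hab Hba]; apply functional_extensionality; intros c.
    apply propositional_extensionality; split; intros Hc.
    + exact (derivable_trans G _ _ _ Hba Hc).
    + exact (derivable_trans G _ _ _ Hab Hc).
Qed.

(** The quotient of formulas by interderivability. The representative is only asserted to exist, so
    by proof irrelevance equality of elements is equality of up-sets. *)
Definition lindenbaum : Type := {P : fml V -> Prop | exists a, P = upset a}.

Definition cls (a : fml V) : lindenbaum :=
  exist _ (upset a) (ex_intro _ a eq_refl).

Lemma cls_surj (x : lindenbaum) : exists a, x = cls a.
Proof.
  destruct x as [P [a Ha]]; exists a; now apply subset_eq_compat.
Qed.

Lemma cls_eq_iff (a b : fml V) :
  cls a = cls b <-> derivable G (a ~> b) /\ derivable G (b ~> a).
Proof.
  rewrite <- upset_eq_iff; split.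
  - intros H; exact (f_equal (@proj1_sig _ _) H).
  - apply subset_eq_compat.
Qed.

Lemma derivable_Imp_congr (a a' b b' : fml V) :
  derivable G (a' ~> a) -> derivable G (b ~> b') ->
  derivable G ((a ~> b) ~> (a' ~> b')).
Proof.
  intros Ha Hb; apply derivable_trans with (a' ~> b).
  - now apply derivable_antitone_l.
  - now apply derivable_monotone_r.
Qed.

(** No representative can be extracted from a class, so the union over all choices is taken;
    congruence of [~>] makes all the up-sets in it coincide. *)
Definition arr_pred (x y : lindenbaum) : fml V -> Prop :=
  fun c => exists a b, x = cls a /\ y = cls b /\ upset (a ~> b) c.

Lemma arr_pred_cls (a b : fml V) : arr_pred (cls a) (cls b) = upset (a ~> b).
Proof.
  apply functional_extensionality; intros c.
  apply propositional_extensionality; split.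
  - intros (a' & b' & Ha & Hb & Hc).
    apply cls_eq_iff in Ha; apply cls_eq_iff in Hb.
    apply derivable_trans with (a' ~> b'); [|exact Hc].
    now apply derivable_Imp_congr.
  - intros Hc; now exists a, b.
Qed.

Lemma arr_pred_upset (x y : lindenbaum) : exists a, arr_pred x y = upset a.
Proof.
  destruct (cls_surj x) as [a ->], (cls_surj y) as [b ->].
  exists (a ~> b); apply arr_pred_cls.
Qed.

Definition lindenbaum_arr (x y : lindenbaum) : lindenbaum :=
  exist _ (arr_pred x y) (arr_pred_upset x y).

Lemma lindenbaum_arr_cls (a b : fml V) :
  lindenbaum_arr (cls a) (cls b) = cls (a ~> b).
Proof.
  apply subset_eq_compat, arr_pred_cls.
Qed.

(* There may be no formula at all (if [V] is empty), so the class [1] is named by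
   an arbitrary given formula [e]. *)
Lemma cls_eq_one_iff (e a : fml V) : cls a = cls (e ~> e) <-> derivable G a.
Proof.
  rewrite cls_eq_iff; split.
  - intros [_ H]; exact (derivable_MP G _ _ (derivable_refl G e) H).
  - intros H; split; apply derivable_T; [apply derivable_refl | exact H].
Qed.

Definition lindenbaum_algebra (e : fml V) : subHilbertAlgebra.
Proof.
  refine (SubHilbertAlgebra lindenbaum lindenbaum_arr (cls (e ~> e)) _ _ _ _ _).
  - intros x y z; destruct (cls_surj x) as [a ->], (cls_surj y) as [b ->],
      (cls_surj z) as [d ->].
    repeat rewrite lindenbaum_arr_cls; apply cls_eq_one_iff, derivable_axiom, ax_B.
  - intros x; destruct (cls_surj x) as [a ->].
    rewrite lindenbaum_arr_cls; apply cls_eq_one_iff, derivable_refl.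
  - intros x; destruct (cls_surj x) as [a ->].
    rewrite lindenbaum_arr_cls; apply cls_eq_one_iff, derivable_T, derivable_refl.
  - intros x y; destruct (cls_surj x) as [a ->], (cls_surj y) as [b ->].
    repeat rewrite lindenbaum_arr_cls; repeat rewrite cls_eq_one_iff.
    intros Hab Hba; now apply cls_eq_iff.
  - intros x y z; destruct (cls_surj x) as [a ->], (cls_surj y) as [b ->],
      (cls_surj z) as [d ->].
    repeat rewrite lindenbaum_arr_cls; apply cls_eq_one_iff, derivable_axiom, ax_S.
(* Kept transparent: the final proof needs [arr] and [one] of this algebra to unfold to the
   components given here. *)
Defined.

End Lindenbaum.

Theorem corollary5p10 (V : Type) (G : fml V -> Prop) (a : fml V) :
  derivable G a <->
  (forall (A : subHilbertAlgebra) (h : fml V -> A),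
     homomorphism h ->
     (forall g : fml V, G g -> h g = one) ->
     h a = one).
Proof.
  split.
  - intros [l Hl] A h Hh HG.
    apply (derivation_sound G A h (a :: l) Hh HG Hl); now left.
  (* The formula [a] itself serves to name the class [1]. The canonical projection [cls G] is the
     test homomorphism, as it sends exactly the consequences of [G] to [1]. *)
  - intros H; apply (cls_eq_one_iff G a a).
    apply (H (lindenbaum_algebra G a) (cls G)).
    + intros b d; symmetry; apply lindenbaum_arr_cls.
    + intros g Hg; apply (cls_eq_one_iff G a g), derivable_premise, Hg.
Qed.
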